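(* Let $\{P_\ell\}_{\ell=1}^{n!}$ be an enumeration of $\mathcal P_n$, let $f:\mathcal P_n\to\mathbb R$, and let $F:\mathcal D_n\to\mathbb R$ be the corresponding Birkhoff extension of $f$. Then (1) $\min_{P\in\mathcal P_n}f(P)=\min_{A\in\mathcal D_n}F(A)$; and (2) $\mathrm{argmin}_{A\in\mathcal D_n}F(A)\subseteq\mathrm{Conv}\big(\mathrm{argmin}_{P\in\mathcal P_n}f(P)\big)$.
   Context: $\mathcal D_n$ is the set of $n\times n$ doubly stochastic matrices (non-negative entries, every row and column sums to $1$); $\mathcal P_n$ is the set of $n\times n$ permutation matrices. $\mathrm{argmin}$ denotes the set of all minimizers and $\mathrm{Conv}$ the convex hull. Continuous Birkhoff decomposition: for $A\in\mathcal D_n$ and the enumeration $\{P_\ell\}_{\ell=1}^{n!}$ of $\mathcal P_n$, the coefficients $\alpha_\ell=\alpha_\ell(A)$ are defined recursively for $\ell=1,\dots,n!$ by $$\alpha_\ell=\min_{i,j}\Big\{A(i,j)-\sum_{m=1}^{\ell-1}\alpha_mP_m(i,j)\ \Big|\ P_\ell(i,j)=1\Big\}.$$ Birkhoff extension: $F(A)=\sum_{\ell:\,\alpha_\ell(A)\neq0}\alpha_\ell(A)f(P_\ell)$. *)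

(* Defs.v *)
From HB Require Import structures.
From mathcomp Require Export all_boot all_order all_algebra.
From mathcomp Require Import perm.
From mathcomp Require Export boolp classical_sets functions cardinality reals convex.

Set Implicit Arguments.
Unset Strict Implicit.
Unset Printing Implicit Defensive.

Export Order.TTheory GRing.Theory Num.Theory.

#[global] Open Scope classical_set_scope.
#[global] Open Scope ring_scope.

Definition doubly_stochastic (R : realType) (n : nat) : set 'M[R]_n :=
  [set A | [/\ forall i j, 0 <= A i j,
               forall i, \sum_j A i j = 1
             & forall j, \sum_i A i j = 1]].

Definition permutation_matrices (R : realType) (n : nat) : set 'M[R]_n :=
  [set A | is_perm_mx A].

Arguments doubly_stochastic : clear implicits.
Arguments permutation_matrices : clear implicits.

Definition is_min (R : realType) (S : set R) (m : R) : Prop :=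
  S m /\ lbound S m.

(* 0 when S has no least element *)
Definition set_min (R : realType) (S : set R) : R :=
  xget 0 [set m | is_min S m].

Definition argmin (R : realType) (T : Type) (X : set T) (g : T -> R) : set T :=
  [set x | X x /\ forall y, X y -> g x <= g y].

(* the convex hull *)
Definition conv (R : realType) (V : lmodType R) (X : set V) : set V :=
  smallest (@convex_set R V) X.

(* The permutation matrices are enumerated from 0: the sequence P is meaningful
   at the indices l < n`! only. *)
Definition enumerates_permutations (R : realType) (n : nat)
    (P : nat -> 'M[R]_n) : Prop :=
  set_bij [set l | (l < n`!)%N] (permutation_matrices R n) P.

Definition min_on_support (R : realType) (n : nat) (B Q : 'M[R]_n) : R :=
  set_min [set B ij.1 ij.2 | ij in [set ij : 'I_n * 'I_n | Q ij.1 ij.2 = 1]].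

(* A - \sum_(m < l) alpha_m P_m; see birkhoff_residualE below *)
Fixpoint birkhoff_residual (R : realType) (n : nat) (P : nat -> 'M[R]_n)
    (A : 'M[R]_n) (l : nat) : 'M[R]_n :=
  if l is k.+1 then
    let B := birkhoff_residual P A k in B - min_on_support B (P k) *: P k
  else A.

(* alpha_l(A); see birkhoff_coefE and birkhoff_coefP below *)
Definition birkhoff_coef (R : realType) (n : nat) (P : nat -> 'M[R]_n)
    (A : 'M[R]_n) (l : nat) : R :=
  min_on_support (birkhoff_residual P A l) (P l).

(* Only the values of f on permutation matrices are used. *)
Definition birkhoff_extension (R : realType) (n : nat) (P : nat -> 'M[R]_n)
    (f : 'M[R]_n -> R) (A : 'M[R]_n) : R :=
  \sum_(l < n`! | birkhoff_coef P A l != 0) birkhoff_coef P A l * f (P l).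

Lemma birkhoff_residualE (R : realType) (n : nat) (P : nat -> 'M[R]_n)
    (A : 'M[R]_n) (l : nat) :
  birkhoff_residual P A l = A - \sum_(m < l) birkhoff_coef P A m *: P m.
Proof.
elim: l => [|l IH]; first by rewrite big_ord0 subr0.
by rewrite big_ord_recr /= opprD addrA -IH.
Qed.

(* the recursion defining the coefficients *)
Lemma birkhoff_coefE (R : realType) (n : nat) (P : nat -> 'M[R]_n)
    (A : 'M[R]_n) (l : nat) :
  birkhoff_coef P A l =
  set_min [set A ij.1 ij.2 - \sum_(m < l) birkhoff_coef P A m * P m ij.1 ij.2
          | ij in [set ij : 'I_n * 'I_n | P l ij.1 ij.2 = 1]].
Proof.
rewrite /birkhoff_coef {1}/min_on_support; congr set_min.
apply: eq_imagel => ij _; rewrite birkhoff_residualE !mxE summxE.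
by congr (_ - _); apply: eq_bigr => m _; rewrite mxE.
Qed.

(* the minimum in the recursion is attained *)
Lemma birkhoff_coefP (R : realType) (n : nat) (P : nat -> 'M[R]_n)
    (A : 'M[R]_n) (l : nat) :
  (0 < n)%N -> enumerates_permutations P -> (l < n`!)%N ->
  is_min [set A ij.1 ij.2 - \sum_(m < l) birkhoff_coef P A m * P m ij.1 ij.2
         | ij in [set ij : 'I_n * 'I_n | P l ij.1 ij.2 = 1]]
         (birkhoff_coef P A l).
Proof.
move=> n0 [/(_ l) Pfun _ _] ln.
rewrite birkhoff_coefE /set_min; set S := [set _ | _ in _].
suff [m Sm] : exists m, is_min S m by exact: (xgetI _ Sm).
have /is_perm_mxP[s Ps] : is_perm_mx (P l) by exact: Pfun.
pose g (ij : 'I_n * 'I_n) :=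
  A ij.1 ij.2 - \sum_(m < l) birkhoff_coef P A m * P m ij.1 ij.2.
pose i0 := Ordinal n0.
have P0 : P l i0 (s i0) == 1 by rewrite Ps !mxE eqxx.
have [ij /eqP Pij le_ij] :=
  @Order.TotalTheory.arg_minP _ _ _ (i0, s i0)
    (fun ij : 'I_n * 'I_n => P l ij.1 ij.2 == 1) g P0.
exists (g ij); split; first by exists ij.
by move=> _ [ij' /eqP Pij' <-]; exact: le_ij.
Qed.

(* Main.v *)
(** Hall's marriage theorem shows that the greedy decomposition of a doubly
    stochastic matrix [A] is exact: after all [n!] steps the residual is
    non-negative with all row and column sums equal to some [c], and step [l]
    created a zero on the support of [P l]; if [c > 0], Hall would give a
    permutation supported on positive entries of the residual.  Hence
    [A = \sum_l alpha_l P_l] is a convex combination and [F A] is the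
    corresponding average of the values [f (P l)].  Permutation matrices being
    extreme, [F] extends [f]; and an average equals the minimum of [f] only if
    all its terms of nonzero weight do. *)
Require Import Defs.
From mathcomp Require Import perm interval_inference.

Set Implicit Arguments.
Unset Strict Implicit.
Unset Printing Implicit Defensive.

(** * Hall's marriage theorem *)

Definition neighbours (T U : finType) (E : {set T * U}) (X : {set T}) :
  {set U} := [set j | [exists i in X, (i, j) \in E]]%SET.

Lemma neighboursP (T U : finType) (E : {set T * U}) (X : {set T}) j :
  reflect (exists2 i, i \in X & (i, j) \in E) (j \in neighbours E X).
Proof. by rewrite inE; exact: exists_inP. Qed.

(* Rado's argument: by submodularity of [X |-> #|neighbours E X|], of two edges
   with a common origin, one can be removed without breaking Hall's condition. *)
Lemma hall_remove_edge (T U : finType) (E : {set T * U}) (x : T) (a b : U) :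
  a != b -> (x, a) \in E -> (x, b) \in E ->
  (forall X : {set T}, #|X| <= #|neighbours E X|)%N ->
  exists2 c, (x, c) \in E &
    (forall X : {set T}, #|X| <= #|neighbours (E :\ (x, c)) X|)%N.
Proof.
move=> ab xa xb hallE.
have [/forallP ha|] := boolP
    [forall X : {set T}, #|X| <= #|neighbours (E :\ (x, a)) X|]%N.
  by exists a.
have [/forallP hb _|] := boolP
    [forall X : {set T}, #|X| <= #|neighbours (E :\ (x, b)) X|]%N.
  by exists b.
rewrite !negb_forall => /existsP[Y]; rewrite -ltnNge => ltY.
move=> /existsP[X]; rewrite -ltnNge => ltX; exfalso.
(* Removing [(x, c)] only shrinks the neighbourhood of sets containing [x], so both violating sets
   contain [x]. *)
have xin c Z : (#|neighbours (E :\ (x, c)) Z| < #|Z|)%N -> x \in Z.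
  apply: contraTT => xZ; rewrite -leqNgt; apply: leq_trans (hallE Z) _.
  apply: subset_leq_card; apply/fintype.subsetP => j /neighboursP[i iZ ij].
  apply/neighboursP; exists i => //; rewrite !inE ij andbT xpair_eqE negb_and.
  by rewrite (contraNneq _ xZ) // => <-.
have xX := xin _ _ ltX; have xY := xin _ _ ltY.
pose NX := neighbours (E :\ (x, a)) X; pose NY := neighbours (E :\ (x, b)) Y.
(* The edge [(x, a)] missing from [NX] survives in [NY], because [a != b] and [x] lies in [Y];
   symmetrically for [b]. *)
have sU : neighbours E (X :|: Y) \subset NX :|: NY.
  apply/fintype.subsetP => j /neighboursP[i iXY ij]; rewrite finset.in_setU.
  have [ix|ix] := eqVneq i x.
    have [ja|ja] := eqVneq j a.
      apply/orP; right; apply/neighboursP; exists x => //.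
      by rewrite !inE xpair_eqE ja (negbTE ab) andbF /= xa.
    apply/orP; left; apply/neighboursP; exists x => //.
    by rewrite !inE xpair_eqE (negbTE ja) andbF /= -ix.
  move: iXY; rewrite finset.in_setU => /orP[iX|iY]; apply/orP; [left|right];
    by apply/neighboursP; exists i; rewrite // !inE xpair_eqE (negbTE ix).
(* Without [x], neither removed edge matters. *)
have sI : neighbours E ((X :&: Y) :\ x) \subset NX :&: NY.
  apply/fintype.subsetP => j /neighboursP[i].
  rewrite !finset.inE => /and3P[ix iX iY] ij.
  by apply/andP; split; apply/exists_inP; exists i; rewrite // !inE xpair_eqE (negbTE ix).
(* Hall's condition on the two sets gives [#|X| + #|Y| - 1 <= #|NX| + #|NY|], while the two
   violations bound the right-hand side by [#|X| + #|Y| - 2]. *)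
have := leq_add (leq_trans (hallE _) (subset_leq_card sU))
                (leq_trans (hallE _) (subset_leq_card sI)).
rewrite cardsUI => le1.
have xXY : x \in X :&: Y by rewrite finset.inE xX.
have := leq_add ltX ltY; rewrite -cardsUI (cardsD1 x (X :&: Y)) xXY.
rewrite addSn addnS addnCA add1n ltnS => /leq_trans/(_ le1).
by rewrite ltnn.
Qed.

(** Induction on the number of edges: as long as some vertex has two edges, one of them can be
    removed. In the end the edges form the graph of a function. *)
Theorem hall_marriage (T U : finType) (E : {set T * U}) :
  (forall X : {set T}, #|X| <= #|neighbours E X|)%N ->
  exists2 s : T -> U, injective s & forall i, (i, s i) \in E.
Proof.
have [k] := ubnP #|E|; elim: k E => // k IH E; rewrite ltnS => leEk hallE.
have [/existsP[x /existsP[a /existsP[b /and3P[ab xa xb]]]]|uniqE] :=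
  boolP [exists x, exists a, exists b, [&& a != b, (x, a) \in E & (x, b) \in E]].
  have [c xc /IH] := hall_remove_edge ab xa xb hallE.
  case=> [|s sinj sE].
    by apply: leq_trans leEk; rewrite [leqRHS](cardsD1 (x, c)) xc.
  by exists s => // i; have := sE i; rewrite inE => /andP[].
have {}uniqE x a b : (x, a) \in E -> (x, b) \in E -> a = b.
  move=> xa xb; apply/eqP; apply: contraNT uniqE => ab.
  apply/existsP; exists x; apply/existsP; exists a; apply/existsP; exists b.
  by rewrite ab xa.
have ex i : exists j, (i, j) \in E.
  have := hallE (finset.set1 i); rewrite cards1 => /card_gt0P[j].
  by move=> /neighboursP[i' /set1P-> ij]; exists j.
pose s i := xchoose (ex i); have sE i : (i, s i) \in E := xchooseP (ex i).
(* A collision would leave the pair [i], [i'] with a single neighbour, against Hall's condition. *)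
exists s => // i i' sii'; apply/eqP; apply: contraT => ii'.
have := hallE [set i; i']%SET; rewrite cards2 ii'.
suff /subset_leq_card : neighbours E [set i; i']%SET \subset finset.set1 (s i).
  by rewrite cards1 => le1 /leq_trans/(_ le1).
apply/fintype.subsetP => j /neighboursP[i0 /set2P[] -> ij]; apply/set1P.
  exact: uniqE ij (sE i).
by rewrite sii'; exact: uniqE ij (sE i').
Qed.

(** * Matrices with constant row and column sums *)

(** Double counting gives Hall's condition for the graph of positive entries: the rows in [X] have
    total mass [c * #|X|], all of it in the columns [neighbours E X], whose total mass is
    [c * #|neighbours E X|]. *)
Lemma positive_permutation (R : realType) (n : nat) (B : 'M[R]_n) (c : R) :
  0 < c -> (forall i j, 0 <= B i j) ->
  (forall i, \sum_j B i j = c) -> (forall j, \sum_i B i j = c) ->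
  exists s : 'S_n, forall i, 0 < B i (s i).
Proof.
move=> c0 B0 Brow Bcol.
pose E : {set 'I_n * 'I_n} := [set ij | 0 < B ij.1 ij.2]%SET.
have [X|s sinj sE] := @hall_marriage _ _ E; last first.
  by exists (perm sinj) => i; have := sE i; rewrite permE inE.
rewrite -(ler_pMn2l c0) -!sumr_const.
rewrite -[leLHS](eq_bigr _ (fun i _ => Brow i)).
rewrite -[leRHS](eq_bigr _ (fun j _ => Bcol j)).
rewrite [leRHS]exchange_big /= [leRHS](bigID (mem X)) /= ler_wpDr //.
  by apply: sumr_ge0 => i _; apply: sumr_ge0.
apply: ler_sum => i iX; rewrite [leLHS](bigID (mem (neighbours E X))) /=.
rewrite [X in _ + X]big1 ?addr0 // => j; apply: contraNeq => Bij.
by apply/neighboursP; exists i; rewrite // inE lt_neqAle eq_sym Bij B0.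
Qed.

Lemma perm_mx_row_sum (R : realType) (n : nat) (s : 'S_n) i :
  \sum_j (perm_mx s : 'M[R]_n) i j = 1.
Proof.
rewrite (bigD1 (s i)) //= !mxE eqxx big1 ?addr0 // => j.
by rewrite !mxE eq_sym => /negbTE->.
Qed.

Lemma perm_mx_col_sum (R : realType) (n : nat) (s : 'S_n) j :
  \sum_i (perm_mx s : 'M[R]_n) i j = 1.
Proof.
rewrite (bigD1 ((s^-1)%g j)) //= !mxE permKV eqxx big1 ?addr0 // => i.
by rewrite -(inj_eq (@perm_inj _ s)) permKV !mxE => /negbTE->.
Qed.

Lemma perm_mx_doubly_stochastic (R : realType) (n : nat) :
  permutation_matrices R n `<=` doubly_stochastic R n.
Proof.
move=> _ /is_perm_mxP[s ->]; split=> [i j|i|j].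
- by rewrite !mxE ler0n.
- exact: perm_mx_row_sum.
- exact: perm_mx_col_sum.
Qed.

(** * Exactness of the greedy decomposition *)

Section BirkhoffDecomposition.
Variables (R : realType) (n : nat) (P : nat -> 'M[R]_n).
Hypotheses (n_gt0 : (0 < n)%N) (P_enum : enumerates_permutations P).
Implicit Types A : 'M[R]_n.

Lemma enum_perm_mx l : (l < n`!)%N -> exists s : 'S_n, P l = perm_mx s.
Proof. by case: P_enum => /(_ l) Pf _ _ /Pf /is_perm_mxP. Qed.

(** The support of [P l] is the graph of [s], so the minimum over positions becomes a minimum over
    rows. *)
Lemma birkhoff_coef_min A l (s : 'S_n) : (l < n`!)%N -> P l = perm_mx s ->
  (exists i, birkhoff_residual P A l i (s i) = birkhoff_coef P A l) /\
  forall i, birkhoff_coef P A l <= birkhoff_residual P A l i (s i).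
Proof.
move=> ln Ps.
have resE i j : A i j - \sum_(m < l) birkhoff_coef P A m * P m i j =
    birkhoff_residual P A l i j.
  rewrite birkhoff_residualE !mxE summxE; congr (_ - _).
  by apply: eq_bigr => m _; rewrite mxE.
have [[[i j] /= Pij eq_ij] le_ij] := birkhoff_coefP A n_gt0 P_enum ln.
split=> [|i'].
  exists i; rewrite -eq_ij resE; suff -> : s i = j by [].
  by apply/eqP; move/eqP: Pij; rewrite Ps !mxE pnatr_eq1 eqb1.
apply: le_ij; exists (i', s i') => /=; last exact: resE.
by rewrite Ps !mxE eqxx.
Qed.

Lemma birkhoff_residualS A l (s : 'S_n) i j : P l = perm_mx s ->
  birkhoff_residual P A l.+1 i j =
  birkhoff_residual P A l i j - birkhoff_coef P A l *+ (s i == j).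
Proof. by move=> Ps; rewrite /= /birkhoff_coef Ps !mxE mulr_natr. Qed.

Variable A : 'M[R]_n.
Hypothesis A_ds : doubly_stochastic R n A.

(** A step changes only the entries on the graph of [s], and subtracts their minimum from them. *)
Lemma birkhoff_residual_ge0 l i j :
  (l <= n`!)%N -> 0 <= birkhoff_residual P A l i j.
Proof.
elim: l i j => [|l IH] i j ln; first by case: A_ds.
have [s Ps] := enum_perm_mx ln.
rewrite (birkhoff_residualS _ _ _ Ps); case: eqP => [<-|_].
  by rewrite subr_ge0; case: (birkhoff_coef_min A ln Ps).
by rewrite subr0 IH // ltnW.
Qed.

Lemma birkhoff_coef_ge0 l : (l < n`!)%N -> 0 <= birkhoff_coef P A l.
Proof.
move=> ln; have [s Ps] := enum_perm_mx ln.
by have [[i <-] _] := birkhoff_coef_min A ln Ps; rewrite birkhoff_residual_ge0 // ltnW.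
Qed.

(** Nonnegative multiples are subtracted, so an entry that has reached zero cannot become positive
    again. *)
Lemma birkhoff_residual_le l m i j : (l <= m)%N -> (m <= n`!)%N ->
  birkhoff_residual P A m i j <= birkhoff_residual P A l i j.
Proof.
elim: m => [|m IH]; first by rewrite leqn0 => /eqP->.
rewrite leq_eqVlt => /predU1P[-> //|]; rewrite ltnS => lm mn.
apply: le_trans (IH lm (ltnW mn)); have [s Ps] := enum_perm_mx mn.
by rewrite (birkhoff_residualS _ _ _ Ps) lerBlDr lerDl mulrn_wge0 ?birkhoff_coef_ge0.
Qed.

(** The common row and column sum of the final residual: each step lowers every such sum by its
    coefficient. *)
Let c := 1 - \sum_(l < n`!) birkhoff_coef P A l.

Lemma birkhoff_residual_row i : \sum_j birkhoff_residual P A n`! i j = c.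
Proof.
rewrite birkhoff_residualE; under eq_bigr do rewrite !mxE summxE.
rewrite sumrB exchange_big /=; have [_ -> _] := A_ds; congr (_ - _).
apply: eq_bigr => l _; have [s ->] := enum_perm_mx (ltn_ord l).
under eq_bigr do rewrite mxE.
by rewrite -mulr_sumr perm_mx_row_sum mulr1.
Qed.

Lemma birkhoff_residual_col j : \sum_i birkhoff_residual P A n`! i j = c.
Proof.
rewrite birkhoff_residualE; under eq_bigr do rewrite !mxE summxE.
rewrite sumrB exchange_big /=; have [_ _ ->] := A_ds; congr (_ - _).
apply: eq_bigr => l _; have [s ->] := enum_perm_mx (ltn_ord l).
under eq_bigr do rewrite mxE.
by rewrite -mulr_sumr perm_mx_col_sum mulr1.
Qed.

Lemma sum_birkhoff_coef : \sum_(l < n`!) birkhoff_coef P A l = 1.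
Proof.
apply/esym/eqP; rewrite -subr_eq0 -/c; apply: contraT => c_neq0.
have B0 i j := birkhoff_residual_ge0 i j (leqnn n`!).
have c_gt0 : 0 < c.
  by rewrite lt_neqAle eq_sym c_neq0 -(birkhoff_residual_row (Ordinal n_gt0)) sumr_ge0.
have [s sB] := positive_permutation c_gt0 B0 birkhoff_residual_row birkhoff_residual_col.
have [_ _ /(_ (perm_mx s))] := P_enum.
case=> [|l /= ln Ps]; first exact: perm_mx_is_perm.
(* Step [l] cancels the entry [(i, s i)] at which its minimum is attained, yet the final residual is
   positive there. *)
have [[i res_i] _] := birkhoff_coef_min A ln Ps.
have := lt_le_trans (sB i) (birkhoff_residual_le i (s i) ln (leqnn _)).
by rewrite (birkhoff_residualS _ _ _ Ps) eqxx res_i subrr ltxx.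
Qed.

(** The final residual is nonnegative and now has zero row sums, hence vanishes. *)
Theorem birkhoff_decomposition :
  A = \sum_(l < n`!) birkhoff_coef P A l *: P l.
Proof.
apply/eqP; rewrite -subr_eq0 -birkhoff_residualE; apply/eqP/matrixP => i j.
have := birkhoff_residual_row i; rewrite /c sum_birkhoff_coef subrr mxE.
move/psumr_eq0P => -> // j' _; exact: birkhoff_residual_ge0.
Qed.

End BirkhoffDecomposition.

(** * The extension at permutation matrices *)

Lemma birkhoff_extensionE (R : realType) (n : nat) (P : nat -> 'M[R]_n)
    (f : 'M[R]_n -> R) (A : 'M[R]_n) :
  birkhoff_extension P f A = \sum_(l < n`!) birkhoff_coef P A l * f (P l).
Proof.
rewrite [RHS](bigID (fun l : 'I__ => birkhoff_coef P A l != 0)) /=.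
rewrite [X in _ + X]big1 ?addr0 // => l.
by rewrite negbK => /eqP->; rewrite mul0r.
Qed.

(* A permutation matrix is an extreme point of the doubly stochastic ones. *)
Lemma birkhoff_coef_perm_mx (R : realType) (n : nat) (P : nat -> 'M[R]_n)
    (Q : 'M[R]_n) (l : nat) :
  (0 < n)%N -> enumerates_permutations P -> permutation_matrices R n Q ->
  (l < n`!)%N -> birkhoff_coef P Q l != 0 -> P l = Q.
Proof.
move=> n_gt0 P_enum Qperm ln coef_neq0.
have Qds := perm_mx_doubly_stochastic Qperm.
have /is_perm_mxP[t Qt] := Qperm.
have [s Ps] := enum_perm_mx P_enum ln.
rewrite Ps Qt; congr perm_mx; apply/permP => i; apply/esym/eqP.
suff : 0 < Q i (s i) by rewrite Qt !mxE; case: eqP => //; rewrite ltxx.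
(* On the graph of [s], the entries of [Q] dominate those of the residual, which dominate the
   positive coefficient. *)
apply: (@lt_le_trans _ _ (birkhoff_coef P Q l)).
  by rewrite lt_neqAle eq_sym coef_neq0 birkhoff_coef_ge0.
have [_ /(_ i)/le_trans] := birkhoff_coef_min n_gt0 P_enum Q ln Ps.
apply; apply: (birkhoff_residual_le n_gt0 P_enum Qds _ _ (leq0n l)).
exact: ltnW.
Qed.

Lemma birkhoff_extension_perm_mx (R : realType) (n : nat) (P : nat -> 'M[R]_n)
    (f : 'M[R]_n -> R) (Q : 'M[R]_n) :
  (0 < n)%N -> enumerates_permutations P -> permutation_matrices R n Q ->
  birkhoff_extension P f Q = f Q.
Proof.
move=> n_gt0 P_enum Qperm; rewrite birkhoff_extensionE.
transitivity (\sum_(l < n`!) birkhoff_coef P Q l * f Q).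
  apply: eq_bigr => l _.
  have [->|coef_neq0] := eqVneq (birkhoff_coef P Q l) 0; first by rewrite !mul0r.
  by rewrite (birkhoff_coef_perm_mx n_gt0 P_enum Qperm _ coef_neq0).
rewrite -mulr_suml sum_birkhoff_coef ?mul1r //.
exact: perm_mx_doubly_stochastic.
Qed.

(** * Convex combinations and minimizers *)

(** The weights are not normalized, so that the induction can pass through partial sums. If the
    total is zero, any point of [C] serves as [z]. *)
Lemma convex_set_conic_sum (R : realType) (V : lmodType R) (C : set V)
    (I : Type) (r : seq I) (D : pred I) (w : I -> R) (x : I -> V) :
  @convex_set R V C -> C !=set0 ->
  (forall i, D i -> 0 <= w i) -> (forall i, D i -> C (x i)) ->
  exists2 z, C z &
    \sum_(i <- r | D i) w i *: x i = (\sum_(i <- r | D i) w i) *: z.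
Proof.
move=> Cconv [z0 Cz0] w_ge0 Cx.
suff [] : 0 <= \sum_(i <- r | D i) w i /\ exists2 z, C z &
    \sum_(i <- r | D i) w i *: x i = (\sum_(i <- r | D i) w i) *: z by [].
elim/big_rec2: _ => [|i v W Di [W0 [z Cz ->]]].
  by split=> //; exists z0; rewrite // scale0r.
have wi0 := w_ge0 _ Di; split; first exact: addr_ge0.
have [/eqP|S_neq0] := eqVneq (w i + W) 0.
  rewrite paddr_eq0 // => /andP[/eqP-> /eqP->].
  by exists z; rewrite // !(addr0, scale0r).
have S_gt0 : 0 < w i + W by rewrite lt_neqAle eq_sym S_neq0 addr_ge0.
have t0 : 0 <= w i / (w i + W) by rewrite divr_ge0 // ltW.
have t1 : w i / (w i + W) <= 1 by rewrite ler_pdivrMr // mul1r lerDl.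
exists ((w i / (w i + W)) *: x i + (1 - w i / (w i + W)) *: z).
  have := Cconv (x i) z (Itv01 t0 t1).
  by rewrite !inE; apply; [exact: Cx | exact: Cz].
rewrite scalerDr !scalerA mulrBr mulr1 [_ * (_ / _)]mulrC divfK //.
by rewrite addrAC subrr add0r.
Qed.

Lemma argmin_perm_mx_nonempty (R : realType) (n : nat) (f : 'M[R]_n -> R) :
  argmin (permutation_matrices R n) f !=set0.
Proof.
have [s _ le_s] := @Order.TotalTheory.arg_minP _ _ _ (1%g : 'S_n) xpredT
  (fun s => f (perm_mx s)) isT.
exists (perm_mx s); split; first exact: perm_mx_is_perm.
by move=> _ /is_perm_mxP[t ->]; exact: le_s.
Qed.

Theorem mainTheorem6 (R : realType) (n : nat) (n_gt0 : (0 < n)%N)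
    (P : nat -> 'M[R]_n) (P_enum : enumerates_permutations P)
    (f : 'M[R]_n -> R) :
  let F := birkhoff_extension P f in
  (exists m : R, is_min (f @` permutation_matrices R n) m /\
                 is_min (F @` doubly_stochastic R n) m) /\
  argmin (doubly_stochastic R n) F `<=`
    conv (argmin (permutation_matrices R n) f).
Proof.
move=> F; have [Q [Qperm Qmin]] := argmin_perm_mx_nonempty f.
have Qds := perm_mx_doubly_stochastic Qperm.
have FQ : F Q = f Q by exact: birkhoff_extension_perm_mx.
have Pperm (l : 'I_(n`!)) : permutation_matrices R n (P l).
  by case: P_enum => /(_ l) + _ _; apply; exact: ltn_ord.
(* As the coefficients sum to 1, the gap of [F] at [A] is the weighted average of the gaps of
   [f]. *)
have FB A : doubly_stochastic R n A ->
    F A - f Q = \sum_(l < n`!) birkhoff_coef P A l * (f (P l) - f Q).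
  move=> Ads; rewrite /F birkhoff_extensionE.
  under [RHS]eq_bigr do rewrite mulrBr.
  by rewrite sumrB -mulr_suml sum_birkhoff_coef // mul1r.
have term_ge0 A (l : 'I_(n`!)) : doubly_stochastic R n A ->
    0 <= birkhoff_coef P A l * (f (P l) - f Q).
  by move=> Ads; rewrite mulr_ge0 ?birkhoff_coef_ge0 // subr_ge0 Qmin.
split.
  exists (f Q); split; split.
  - by exists Q.
  - by move=> _ [Q' Q'perm <-]; exact: Qmin.
  - by exists Q.
  - move=> _ [A Ads <-]; rewrite -subr_ge0 FB // sumr_ge0 // => l _.
    exact: term_ge0.
(* [conv] is an intersection, so membership is tested on an arbitrary convex [C] containing the
   minimizers of [f]. *)
move=> A [Ads Amin] C [Cconv subC].
have /psumr_eq0P sum0 : \sum_(l < n`!) birkhoff_coef P A l * (f (P l) - f Q) = 0.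
  apply/eqP; rewrite eq_le sumr_ge0 ?andbT => [|l _]; last exact: term_ge0.
  by rewrite -FB // subr_le0 -FQ Amin.
have C_P (l : 'I_(n`!)) : birkhoff_coef P A l != 0 -> C (P l).
  move=> coef_neq0; apply: subC; split=> // y /Qmin.
  have /eqP := sum0 (fun l _ => term_ge0 A l Ads) l isT.
  by rewrite mulf_eq0 (negbTE coef_neq0) subr_eq0 => /eqP->.
have C_neq0 : C !=set0 by exists Q; exact: subC.
have [z Cz] := convex_set_conic_sum (index_enum _) Cconv C_neq0
  (fun l _ => birkhoff_coef_ge0 n_gt0 P_enum Ads (ltn_ord l)) C_P.
(* [C_P] covers nonzero coefficients only, so the combination was formed over those indices; the
   full sums are recovered here. *)
have dropped (V : nmodType) (h : 'I_(n`!) -> V) :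
    (forall l : 'I_(n`!), birkhoff_coef P A l = 0 -> h l = 0) ->
    \sum_(l < n`! | birkhoff_coef P A l != 0) h l = \sum_(l < n`!) h l.
  move=> h0; rewrite [RHS](bigID (fun l : 'I__ => birkhoff_coef P A l != 0)) /=.
  by rewrite [X in _ + X]big1 ?addr0 // => l; rewrite negbK => /eqP/h0.
rewrite !dropped // => [|l ->]; last by rewrite scale0r.
by rewrite sum_birkhoff_coef // scale1r -birkhoff_decomposition // => ->.
Qed.
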